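(* Every Kähler affine curvature model is geometrically realizable by an affine Kähler manifold. That is: let $V$ be a real vector space of even dimension $m=2\bar m$, let $J\in\operatorname{End}(V)$ satisfy $J^2=-\operatorname{Id}$, and let $\mathcal{A}\in\operatorname{End}(V)\otimes V^*\otimes V^*$, written $(x,y)\mapsto\mathcal{A}(x,y)\in\operatorname{End}(V)$, satisfy for all $x,y,z\in V$ $$\mathcal{A}(x,y)=-\mathcal{A}(y,x),\qquad \mathcal{A}(x,y)z+\mathcal{A}(y,z)x+\mathcal{A}(z,x)y=0,\qquad \mathcal{A}(x,y)J=J\mathcal{A}(x,y).$$ Then there exist an affine Kähler manifold $(M,J_M,\nabla)$, a point $P\in M$, and a linear isomorphism $\Xi:V\to T_PM$ such that $\Xi^*\mathcal{R}_P=\mathcal{A}$ and $\Xi^*(J_M)_P=J$, where $\mathcal{R}$ is the curvature operator of $\nabla$.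
   Context: An affine Kähler manifold $(M,J_M,\nabla)$ is a smooth manifold $M$ of dimension $m=2\bar m$ together with an integrable almost complex structure $J_M$ on $M$ (i.e. there are local charts $(x_1,\dots,x_{\bar m},y_1,\dots,y_{\bar m})$ near each point with $J_M\partial_{x_i}=\partial_{y_i}$ and $J_M\partial_{y_i}=-\partial_{x_i}$) and a torsion free connection $\nabla$ on $TM$ with $\nabla(J_M)=0$. The curvature operator of $\nabla$ is $\mathcal{R}(x,y)=\nabla_x\nabla_y-\nabla_y\nabla_x-\nabla_{[x,y]}$. Pullback by $\Xi$ is defined by $(\Xi^*\mathcal{R}_P)(x,y)z=\Xi^{-1}\big(\mathcal{R}_P(\Xi x,\Xi y)\Xi z\big)$ and $\Xi^*(J_M)_P=\Xi^{-1}\circ (J_M)_P\circ\Xi$. *)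

(* Defs.v *)
From HB Require Import structures.
From mathcomp Require Import all_boot all_order all_algebra.
From mathcomp Require Import all_classical all_reals all_analysis.
From mathcomp Require Import ring.

Set Implicit Arguments.
Unset Strict Implicit.
Unset Printing Implicit Defensive.

Import Order.TTheory GRing.Theory Num.Theory numFieldNormedType.Exports.

Local Open Scope classical_set_scope.
Local Open Scope ring_scope.

Section Smooth.
Context {R : realType} {n : nat} {W : normedModType R}.
Implicit Types (U : set 'rV[R]_n) (f g : 'rV[R]_n -> W).

Definition partial (i : 'I_n) f (x : 'rV[R]_n) : W := 'D_(delta_mx 0 i) f x.

(* All partial derivatives of order at most [k] exist and are continuous at
   every point of [U]; meant for open [U] only. *)
Fixpoint Ck (k : nat) U f : Prop :=
  (forall x, U x -> {for x, continuous f}) /\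
  (if k is k'.+1 then
     forall i, (forall x, U x -> derivable f x (delta_mx 0 i)) /\
               Ck k' U (partial i f)
   else True).

Definition smooth_on U f : Prop := forall k, Ck k U f.

Lemma near_eq_on U f g x : open U -> (forall y, U y -> f y = g y) -> U x ->
  {near x, f =1 g}.
Proof.
move=> oU fg Ux; have : nbhs x U by exact: open_nbhs_nbhs.
by apply: filterS => y /fg.
Qed.

Lemma continuous_for_ext U f g x : open U -> (forall y, U y -> f y = g y) ->
  U x -> {for x, continuous f} -> {for x, continuous g}.
Proof.
move=> oU fg Ux; rewrite /prop_for /continuous_at -(fg _ Ux) => fc.
by apply: cvg_trans fc; have /near_eq_cvg := near_eq_on oU fg Ux.
Qed.

Lemma Ck_ext k U f g : open U -> (forall x, U x -> f x = g x) ->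
  Ck k U f -> Ck k U g.
Proof.
move=> oU; elim: k f g => [|k IH] f g fg [fc fS].
  by split=> // x Ux; exact: continuous_for_ext oU fg Ux (fc x Ux).
split=> [x Ux|i]; first exact: continuous_for_ext oU fg Ux (fc x Ux).
have [fd fk] := fS i; split=> [x Ux|].
  exact: near_eq_derivable (near_eq_on oU fg Ux) (fd x Ux).
by apply: IH fk => x Ux; exact: near_eq_derive (near_eq_on oU fg Ux).
Qed.

Lemma Ck_S k U f : Ck k.+1 U f -> Ck k U f.
Proof.
elim: k f => [|k IH] f [fc fS]; first by split.
by split=> // i; have [fd /IH] := fS i.
Qed.

Lemma Ck_cst k U (w : W) : open U -> Ck k U (cst w).
Proof.
move=> oU; elim: k w => [|k IH] w.
  by split=> // x _; apply: cst_continuous.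
split=> [x _|i]; first by apply: cst_continuous.
split=> [x _|]; first exact: derivable_cst.
by apply: (Ck_ext oU _ (IH 0)) => x _; rewrite /partial derive_cst.
Qed.

Lemma CkD k U f g : open U -> Ck k U f -> Ck k U g -> Ck k U (f + g).
Proof.
move=> oU; elim: k f g => [|k IH] f g [fc fS] [gc gS].
  by split=> // x Ux; apply: continuousD; [exact: fc|exact: gc].
split=> [x Ux|i]; first by apply: continuousD; [exact: fc|exact: gc].
have [[fd fk] [gd gk]] := (fS i, gS i).
split=> [x Ux|]; first by apply: derivableD; [exact: fd|exact: gd].
apply: (Ck_ext oU _ (IH _ _ fk gk)) => x Ux.
by rewrite /partial deriveD//; [exact: fd|exact: gd].
Qed.
End Smooth.

Lemma CkM (R : realType) n k (U : set 'rV[R]_n) (f g : 'rV[R]_n -> R^o) :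
  open U -> Ck k U f -> Ck k U g -> Ck k U (f * g).
Proof.
move=> oU; elim: k f g => [|k IH] f g fC gC.
  by split=> // x Ux; apply: continuousM; [exact: fC.1|exact: gC.1].
split=> [x Ux|i]; first by apply: continuousM; [exact: fC.1|exact: gC.1].
have [[fd fk] [gd gk]] := (fC.2 i, gC.2 i).
split=> [x Ux|]; first by apply: derivableM; [exact: fd|exact: gd].
apply: (@Ck_ext _ _ _ _ _ (f * partial i g + g * partial i f)) => //.
  by move=> x Ux; rewrite /partial deriveM//; [exact: fd|exact: gd].
by apply: CkD => //; apply: IH => //; exact: Ck_S.
Qed.

Record chart (R : realType) (n : nat) (T : topologicalType) := Chart {
  cdom : set T;
  cmap : T -> 'rV[R]_n;
  cinv : 'rV[R]_n -> T;
  cdom_open : open cdom;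
  cimg_open : open (cmap @` cdom);
  cmapK : forall p, cdom p -> cinv (cmap p) = p;
  cmap_cont : forall p, cdom p -> {for p, continuous cmap};
  cinv_cont : forall x, (cmap @` cdom) x -> {for x, continuous cinv} }.

Definition cimg R n T (c : chart R n T) : set 'rV[R]_n := cmap c @` cdom c.

Definition transition_smooth R n T (c d : chart R n T) : Prop :=
  smooth_on (cmap c @` (cdom c `&` cdom d)) (cmap d \o cinv c).

Record manifold (R : realType) (n : nat) := Manifold {
  mspace :> topologicalType;
  mspace_hausdorff : hausdorff_space mspace;
  mspace_second_countable : @second_countable mspace;
  atlas : set (chart R n mspace);
  atlas_cover : forall p, exists2 c, atlas c & cdom c p;
  atlas_compat : forall c d, atlas c -> atlas d -> transition_smooth c d }.

(* [atlas] is not required to be maximal; these are the charts of the maximal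
   atlas that contains it. *)
Definition compatible_chart R n (M : manifold R n) (c : chart R n M) : Prop :=
  forall d, atlas d -> transition_smooth c d /\ transition_smooth d c.

Section SmoothFunctions.
Context {R : realType} {n : nat} (M : manifold R n).

Definition smooth_fun : {pred M -> R^o} := fun f =>
  `[< forall c : chart R n M, atlas c -> smooth_on (cimg c) (f \o cinv c) >].

Lemma smooth_fun_cst a : cst a \in smooth_fun.
Proof. by apply/asboolP => c _ k; exact: (Ck_cst k a (@cimg_open _ _ _ c)). Qed.

Lemma smooth_funD : {in smooth_fun &, forall f g, f + g \in smooth_fun}.
Proof.
move=> f g /asboolP fS /asboolP gS; apply/asboolP => c cA k.
exact: (CkD (@cimg_open _ _ _ c) (fS c cA k) (gS c cA k)).
Qed.

Lemma smooth_funM : {in smooth_fun &, forall f g, f * g \in smooth_fun}.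
Proof.
move=> f g /asboolP fS /asboolP gS; apply/asboolP => c cA k.
exact: (CkM (@cimg_open _ _ _ c) (fS c cA k) (gS c cA k)).
Qed.

Lemma smooth_fun_submod : GRing.submod_closed smooth_fun.
Proof.
split=> [|a f g fS gS]; first exact: smooth_fun_cst.
apply: smooth_funD gS.
by have := smooth_funM (smooth_fun_cst a) fS; congr (_ \in _).
Qed.

HB.instance Definition _ := GRing.isSubmodClosed.Build R (M -> R^o) smooth_fun
  (GRing.submod_closed_semi smooth_fun_submod).

Lemma smooth_fun_subring : subring_closed smooth_fun.
Proof.
split; [exact: smooth_fun_cst| |exact: smooth_funM].
by move=> f g fS gS; rewrite rpredB.
Qed.

Record cinfty := Cinfty {
  cinfty_fun :> M -> R^o;
  cinfty_smooth : cinfty_fun \in smooth_fun }.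

HB.instance Definition _ := [isSub for cinfty_fun].
HB.instance Definition _ := [Choice of cinfty by <:].
HB.instance Definition _ := GRing.SubChoice_isSubComPzRing.Build
  (M -> R^o) smooth_fun cinfty smooth_fun_subring.
HB.instance Definition _ := [SubZmodule_isSubLmodule of cinfty by <:].

Lemma cinfty_scaleAr a (f g : cinfty) : f * (a *: g) = a *: (f * g).
Proof. by apply/val_inj/funext => p /=; exact: mulrCA. Qed.
End SmoothFunctions.

Section VectorFields.
Context {R : realType} {n : nat} (M : manifold R n).
Local Notation A := (cinfty M).

(* The tangent space at [p] is the space of derivations of the algebra of
   smooth functions at [p]. *)
Definition derivation_at (p : M) : {pred A -> R^o} := fun v =>
  `[< (forall (a : R) (f g : A), v (a *: f + g) = a * v f + v g) /\
      (forall f g : A, v (f * g) = f p * v g + g p * v f) >].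

Lemma derivation_at_submod p : GRing.submod_closed (derivation_at p).
Proof.
split=> [|a u v /asboolP[uL uM] /asboolP[vL vM]].
  have E (f : A) : (0 : A -> R^o) f = 0 by [].
  by apply/asboolP; split=> *; rewrite !E !mulr0 addr0.
have E (f : A) : (a *: u + v) f = a * u f + v f by [].
by apply/asboolP; split=> [b f g|f g]; rewrite !E ?(uL, vL, uM, vM); ring.
Qed.

HB.instance Definition _ p := GRing.isSubmodClosed.Build R (A -> R^o)
  (derivation_at p) (GRing.submod_closed_semi (derivation_at_submod p)).

Record tangent (p : M) := Tangent {
  tangent_fun :> A -> R^o;
  tangent_der : tangent_fun \in derivation_at p }.

HB.instance Definition _ p := [isSub for @tangent_fun p].
HB.instance Definition _ p := [Choice of tangent p by <:].
HB.instance Definition _ p := [SubChoice_isSubLmodule of tangent p by <:].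

(* The module of vector fields over the ring [A] is that of the derivations of
   [A]; [A^o] is [A] as a module over itself. *)
Definition derivation : {pred A -> A^o} := fun X =>
  `[< (forall (a : R) (f g : A), X (a *: f + g) = a *: (X f : A) + X g) /\
      (forall f g : A, X (f * g) = f * X g + g * X f) >].

Lemma derivation_submod : GRing.submod_closed derivation.
Proof.
split=> [|h u v /asboolP[uL uM] /asboolP[vL vM]].
  have E (f : A) : (0 : A -> A^o) f = 0 by [].
  by apply/asboolP; split=> *; rewrite !E ?scaler0 ?mulr0 addr0.
have E (f : A) : (h *: u + v) f = h * u f + v f by [].
apply/asboolP; split=> [b f g|f g]; rewrite !E ?(uL, vL, uM, vM); last by ring.
by rewrite mulrDr scalerDr cinfty_scaleAr addrACA.
Qed.

HB.instance Definition _ := GRing.isSubmodClosed.Build A (A -> A^o)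
  derivation (GRing.submod_closed_semi derivation_submod).

Record vfield := Vfield {
  vfield_fun :> A -> A^o;
  vfield_der : vfield_fun \in derivation }.

HB.instance Definition _ := [isSub for vfield_fun].
HB.instance Definition _ := [Choice of vfield by <:].
HB.instance Definition _ := [SubChoice_isSubLmodule of vfield by <:].

Lemma vf_at_der (p : M) (X : vfield) :
  (fun f => (X f : A) p) \in derivation_at p.
Proof.
have /asboolP[XL XM] := vfield_der X; apply/asboolP.
by split=> *; rewrite ?XL ?XM.
Qed.

Definition vf_at (p : M) (X : vfield) : tangent p := Tangent (vf_at_der p X).

Lemma bracket_der (X Y : vfield) :
  (fun f => (X (Y f) : A) - Y (X f)) \in derivation.
Proof.
have /asboolP[XL XM] := vfield_der X; have /asboolP[YL YM] := vfield_der Y.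
have XD f g : X (f + g) = (X f : A) + X g.
  by have := XL 1 f g; rewrite !scale1r.
have YD f g : Y (f + g) = (Y f : A) + Y g.
  by have := YL 1 f g; rewrite !scale1r.
apply/asboolP; split=> [a f g|f g]; rewrite ?(XL, YL, XM, YM).
  by rewrite scalerBr opprD addrACA.
by rewrite XD YD !(XM, YM); ring.
Qed.

Definition bracket X Y : vfield := Vfield (bracket_der X Y).

(* The [i]-th coordinate vector of the chart [c] at [p], as the functional it
   induces on smooth functions. *)
Definition coord_vec (c : chart R n M) (p : M) (i : 'I_n) (f : A) : R :=
  partial i (f \o cinv c) (cmap c p).

Record connection := Connection {
  nabla :> vfield -> vfield -> vfield;
  nablaDl : forall X Y Z, nabla (X + Y) Z = nabla X Z + nabla Y Z;
  nablaZl : forall (f : A) X Z, nabla (f *: X) Z = f *: nabla X Z;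
  nablaDr : forall X Y Z, nabla X (Y + Z) = nabla X Y + nabla X Z;
  nablaZr : forall (f : A) X Y,
    nabla X (f *: Y) = (X f : A) *: Y + f *: nabla X Y }.

Definition torsion_free (D : connection) : Prop :=
  forall X Y, D X Y - D Y X = bracket X Y.

Definition curvature (D : connection) (X Y Z : vfield) : vfield :=
  D X (D Y Z) - D Y (D X Z) - D (bracket X Y) Z.

Definition extension (p : M) (u : tangent p) : vfield :=
  xget 0 [set X | vf_at p X = u].

(* Every tangent vector extends to a vector field, and [curvature D] is
   [A]-trilinear, so its value at [p] only depends on the values of its
   arguments at [p]: any extensions would do. *)
Definition curvature_at (D : connection) (p : M) (u v w : tangent p) :
    tangent p :=
  vf_at p (curvature D (extension u) (extension v) (extension w)).

(* [acs_field] is the action of [acs_at] on vector fields; that it exists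
   expresses the smoothness of [acs_at]. *)
Record almost_complex := AlmostComplex {
  acs_at :> forall p : M, {linear tangent p -> tangent p};
  acs_field : vfield -> vfield;
  acs_fieldE : forall p X, vf_at p (acs_field X) = acs_at p (vf_at p X);
  acs_sq : forall p (u : tangent p), acs_at p (acs_at p u) = - u }.

Definition parallel_acs (D : connection) (J : almost_complex) : Prop :=
  forall X Y, D X (acs_field J Y) = acs_field J (D X Y).
End VectorFields.

Section Kaehler.
Context {R : realType} {m : nat}.

(* The coordinates of ['rV_(m + m)] are (x_1, ..., x_m, y_1, ..., y_m). *)
Definition complex_chart (M : manifold R (m + m)) (J : almost_complex M)
    (c : chart R (m + m) M) : Prop :=
  forall p, cdom c p -> forall i : 'I_m, exists dx dy : tangent p,
    [/\ forall f, dx f = coord_vec c p (lshift m i) f,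
        forall f, dy f = coord_vec c p (rshift m i) f,
        J p dx = dy & J p dy = - dx].

Definition integrable_acs (M : manifold R (m + m)) (J : almost_complex M) :
    Prop :=
  forall p, exists c : chart R (m + m) M,
    [/\ compatible_chart c, cdom c p & complex_chart J c].
End Kaehler.

Record affine_kaehler (R : realType) (m : nat) := AffineKaehler {
  ak_manifold :> manifold R (m + m);
  ak_J : almost_complex ak_manifold;
  ak_nabla : connection ak_manifold;
  ak_integrable : integrable_acs ak_J;
  ak_torsion_free : torsion_free ak_nabla;
  ak_parallel : parallel_acs ak_nabla ak_J }.

(* Main.v *)
Require Import Defs.
From HB Require Import structures.
From mathcomp Require Import all_boot all_order all_algebra.
From mathcomp Require Import all_classical all_reals all_analysis.
From mathcomp Require Import ring lra.

(* The manifold is R^(2m) with its standard complex structure, for a basis of V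
   of the form (e, J e), and the connection is the flat one plus a tensor
   T(x; Y, Z) that is linear in the position x; its curvature at the origin is
   T(X; Y, Z) - T(Y; X, Z).  Split A(x, y) into its part of type (2,0), which is
   (A(x, y) - A(Jx, Jy)) / 2, and its part of type (1,1), which is
   (A(x, y) + A(Jx, Jy)) / 2; by the Bianchi identity there is no (0,2) part.
   The (1,1) part is S(x; y, z) - S(y; x, z), where S is antilinear in x and
   complex bilinear in (y, z), and the Bianchi identity makes S symmetric in
   (y, z).  The (2,0) part Q satisfies the Bianchi identity on its own and is
   the curvature of (Q(x, y) z + Q(x, z) y) / 3, as in the real case.  Since
   tangent vectors and fields are derivations, Hadamard's lemma is what gives
   them coordinates. *)

Set Implicit Arguments.
Unset Strict Implicit.
Unset Printing Implicit Defensive.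

Import Order.TTheory GRing.Theory Num.Theory numFieldNormedType.Exports.

Local Open Scope classical_set_scope.
Local Open Scope ring_scope.

(** * Hadamard's lemma *)

Section UnitIntegral.
Context {R : realType}.
Implicit Types f g F : R -> R.

Definition uint f : R := (\int[lebesgue_measure]_(t in `[0%R, 1%R]) f t)%R.

Lemma uint_integrable f : continuous f ->
  lebesgue_measure.-integrable `[0%R, 1%R] (EFin \o f).
Proof.
move=> cf; apply: continuous_compact_integrable; first exact: segment_compact.
exact: continuous_subspaceT.
Qed.

Lemma uintB f g : continuous f -> continuous g ->
  uint (fun t => f t - g t) = uint f - uint g.
Proof. by move=> cf cg; apply: RintegralB => //; exact: uint_integrable. Qed.

Lemma uintZ f c : continuous f -> uint (fun t => c * f t) = c * uint f.
Proof. by move=> cf; apply: RintegralZl => //; exact: uint_integrable. Qed.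

Lemma le_norm_uint f e : continuous f ->
  (forall t, 0 <= t <= 1 -> `|f t| <= e) -> `|uint f| <= e.
Proof.
move=> cf fe.
apply: le_trans (le_normr_Rintegral _ (uint_integrable cf)) _ => //.
have cn : continuous (fun t => `|f t|).
  by move=> t; apply: continuous_comp; [exact: cf|exact: norm_continuous].
apply: (@le_trans _ _ (uint (cst e))).
  apply: le_Rintegral => //; first exact: uint_integrable.
  by apply: uint_integrable => t; exact: cst_continuous.
rewrite /uint Rintegral_cst//=.
by rewrite lebesgue_measure_itv/= lte_fin ltr01 oppr0 adde0 mulr1.
Qed.

Lemma uint_FTC f F : continuous f -> (forall t : R, is_derive t 1 F (f t)) ->
  uint f = F 1 - F 0.
Proof.
move=> cf dF; rewrite /uint /Rintegral (@continuous_FTC2 _ _ F)//.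
- exact: continuous_subspaceT.
- have cF t : {for t, continuous F}.
    have [? _] := dF t.
    by apply: differentiable_continuous; apply/derivable1_diffP.
  split => [t _||]; first by have [] := dF t.
  + by apply: cvg_at_right_filter; exact: cF.
  + by apply: cvg_at_left_filter; exact: cF.
- by move=> t _; rewrite derive1E; apply: derive_val.
Qed.

End UnitIntegral.

(** * Continuity and differentiation under the integral sign *)

Section ParameterIntegral.
Context {R : realType} {n : nat}.
Local Notation V := 'rV[R]_n.

(** This is the tube lemma: joint continuity gives a neighbourhood of [x] for each [t], and
    compactness of [0, 1] makes one neighbourhood serve all [t]. *)
Lemma near_uniform_unit_itv (F : V -> R -> R) (x : V) (e : R) : 0 < e ->
  continuous (fun z : V * R => F z.1 z.2) ->
  \forall y \near x, forall t, 0 <= t <= 1 -> `|F x t - F y t| <= e.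
Proof.
move=> e0 cF.
have /compact_near_coveringP := @segment_compact R 0 1.
move=> /(_ _ (nbhs x) (fun y t => `|F x t - F y t| <= e) _) near01.
apply: filterS (near01 _) => [y Hy t t01|].
  by apply: Hy; rewrite /= in_itv.
move=> t _.
have e20 : 0 < e / 2 by rewrite divr_gt0.
have := cF (x, t) => /cvgrPdist_le /(_ _ e20) [[P Q] /= [Px Qt] PQ].
exists (Q, P); first by [].
case=> s y /= [Qs Py].
(* Both [F x s] and [F y s] lie within [e / 2] of [F x t]. *)
have h1 := PQ (x, s) (conj (nbhs_singleton Px) Qs).
have h2 := PQ (y, s) (conj Py Qs).
have -> : F x s - F y s = - (F x t - F x s) + (F x t - F y s) by ring.
by apply: le_trans (ler_normD _ _) _; rewrite normrN /= in h1 h2 *; lra.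
Qed.

Lemma continuous_slice (F : V -> R -> R) (x : V) :
  continuous (fun z : V * R => F z.1 z.2) -> continuous (F x).
Proof.
move=> cF t; apply: (@continuous_comp _ _ _ (fun t : R => (x, t))
  (fun z : V * R => F z.1 z.2)).
  exact: (cvg_pair (cvg_cst x) cvg_id).
exact: cF.
Qed.

Lemma continuous_uint (F : V -> R -> R) :
  continuous (fun z : V * R => F z.1 z.2) -> continuous (fun x => uint (F x)).
Proof.
move=> cF x; apply/(@cvgrPdist_le _ _ _ (nbhs x)) => e e0.
apply: filterS (near_uniform_unit_itv x e0 cF) => y Hy.
rewrite -uintB; [|exact: continuous_slice cF..].
apply: le_norm_uint => // t.
by apply: continuousB; exact: continuous_slice cF _.
Qed.

(** The two difference quotients are the same function of [h]; one-variable results thus apply to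
    derivatives along [v]. *)
Lemma is_derive_lineP (f : V -> R^o) (v y : V) (s d : R) :
  is_derive s 1 (fun r : R => f (r *: v + y) : R) d <->
  is_derive (s *: v + y) v f d.
Proof.
have E :
  (fun h : R => h^-1 *: (f ((h *: (1 : R) + s) *: v + y) - f (s *: v + y))) =
  (fun h => h^-1 *: (f (h *: v + (s *: v + y)) - f (s *: v + y))).
  by apply/funext => h; rewrite scalerDl [h *: 1]mulr1 addrA.
by split=> -[]; rewrite /derivable /derive /= ?E => df <-; apply: DeriveDef;
  rewrite /derivable /derive /= ?E.
Qed.

Lemma is_derive_line (f : V -> R^o) (v y : V) (c s : R) :
  derivable f ((s * c) *: v + y) v ->
  is_derive s 1 (fun r : R => f ((r * c) *: v + y) : R)
    (c * 'D_v f ((s * c) *: v + y)).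
Proof.
move=> /derivableP /is_derive_lineP dl.
have dm : is_derive s 1 (fun r : R => r * c) c.
  have := is_deriveZ c (is_derive_id s (1 : R)).
  rewrite [c *: 1]mulr1; congr (is_derive _ _ _ _).
  by apply/funext => r; rewrite /= mulrC.
rewrite mulrC.
exact: (@is_derive1_comp R (fun r : R => f (r *: v + y)) (fun r => r * c)).
Qed.

(** The mean value theorem turns the difference quotient of [F ^~ t] into a value of [F'] at a
    nearby point, which is close to [F' x t] uniformly in [t]; this bound is then integrated. *)
Lemma is_derive_uint (F F' : V -> R -> R) (v x : V) :
  continuous (fun z : V * R => F z.1 z.2) ->
  continuous (fun z : V * R => F' z.1 z.2) ->
  (forall y t, is_derive y v (F ^~ t : V -> R^o) (F' y t)) ->
  is_derive x v (fun y => uint (F y) : R^o) (uint (F' x)).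
Proof.
move=> cF cF' dF.
have key : (fun h : R => h^-1 *: ((uint (F (h *: v + x)) : R^o) - uint (F x)))
    @ 0^' --> (uint (F' x) : R^o).
  apply/cvgrPdist_le => e e0.
  have /nbhs_ballP [d /= d0 Hd] : nbhs (0 : R) [set h : R |
      forall t, 0 <= t <= 1 -> `|F' x t - F' (h *: v + x) t| <= e].
    have := near_uniform_unit_itv x e0 cF'.
    have /(_ 0) : continuous (fun h : R => h *: v + x).
      move=> h; apply: (@continuousD _ _ _ (fun h : R => h *: v) (cst x)).
        exact: scalel_continuous.
      exact: cst_continuous.
    by rewrite /continuous_at scale0r add0r; apply.
  apply/nbhs_ballP; exists d => // h /= hd h0.
  (* Multiplying by [h] removes the quotient; it remains to bound a single integral by [e] times the
     absolute value of [h]. *)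
  rewrite [_ *: _]mulrC -[uint (F' x)](mulfK h0) [_ * h]mulrC.
  rewrite -uintZ; last exact: continuous_slice cF' .
  rewrite -mulrBl normrM -uintB; [|exact: continuous_slice cF..].
  have cFF : continuous (fun t => F (h *: v + x) t - F x t).
    by move=> t; apply: continuousB; exact: continuous_slice cF _.
  have chF : continuous (fun t => h * F' x t).
    move=> t; apply: continuousM; first exact: cst_continuous.
    exact: continuous_slice cF' _.
  rewrite -uintB// normfV ler_pdivrMr ?normr_gt0//.
  apply: le_norm_uint => [t|t t01].
    exact: (@continuousB _ R^o _ _ _ _ (chF t) (cFF t)).
  have dl (s : R) :
      is_derive s 1 (fun r : R => F (r *: v + x) t) (F' (s *: v + x) t).
    exact/(is_derive_lineP (F ^~ t : V -> R^o)).
  have cl : continuous (fun r : R => F (r *: v + x) t).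
    move=> s; have [? _] := dl s.
    exact/differentiable_continuous/derivable1_diffP.
  have [c cd ->] : exists2 c, `|c| < d &
      F (h *: v + x) t - F x t = F' (c *: v + x) t * h.
    move: hd; rewrite /ball /= sub0r normrN => hd.
    (* [MVT_segment] wants ordered endpoints, so a negative [h] uses [h, 0] in place of [0, h]. *)
    have [h0'|h0'] := leP 0 h.
      have [c + E] :=
        MVT_segment h0' (fun s _ => dl s) (continuous_subspaceT cl).
      rewrite in_itv/= => /andP[c0 ch]; exists c.
        by move: hd; rewrite !ger0_norm//; exact: le_lt_trans.
      by rewrite subr0 scale0r add0r in E.
    have [c + E] :=
      MVT_segment (ltW h0') (fun s _ => dl s) (continuous_subspaceT cl).
    rewrite in_itv/= => /andP[c0 ch]; exists c.
      by move: hd; rewrite ltr0_norm// ler0_norm//; lra.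
    by move: E; rewrite scale0r add0r sub0r; lra.
  rewrite [_ * h]mulrC -mulrBr normrM mulrC ler_wpM2r//.
  by apply: Hd => //; rewrite /ball /= sub0r normrN.
apply: DeriveDef; first by apply/cvg_ex; exists (uint (F' x)).
exact: cvg_lim key.
Qed.

End ParameterIntegral.

(** * Hadamard's lemma, one coordinate at a time *)

Section Hadamard.
Context {R : realType} {n : nat}.
Local Notation V := 'rV[R]_n.
Implicit Types (x y : V) (i j : 'I_n) (a t : R) (h : V -> R^o).

(* Replaces the coordinate [x_i] by [a + t (x_i - a)]. *)
Definition squeeze i a t x : V := x + ((1 - t) * (a - x 0 i)) *: delta_mx 0 i.

Lemma squeezeE i a t x j :
  squeeze i a t x 0 j = if j == i then a + t * (x 0 i - a) else x 0 j.
Proof.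
rewrite /squeeze !mxE /=; case: eqVneq => [->|_]; last by rewrite mulr0 addr0.
by rewrite mulr1; ring.
Qed.

Lemma squeeze1 i a x : squeeze i a 1 x = x.
Proof. by rewrite /squeeze subrr mul0r scale0r addr0. Qed.

(** The exponent [(j == i)] is a boolean read as 0 or 1, so the two chain rule factors, 1 and [t],
    share one formula. *)
Lemma squeeze_shift i a t x j (s : R) :
  squeeze i a t (s *: delta_mx 0 j + x) =
  (s * t ^+ (j == i)) *: delta_mx 0 j + squeeze i a t x.
Proof.
apply/rowP => k; rewrite !(squeezeE, mxE) /= ![_ == j]eq_sym.
case: (eqVneq k i) => [->|ki]; first by case: (j == i) => /=; ring.
case: (eqVneq j k) => [->|_]; last by rewrite !mulr0.
by rewrite (negPf ki); ring.
Qed.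

Lemma squeeze_line i a t x :
  squeeze i a t x = (t * (x 0 i - a)) *: delta_mx 0 i + squeeze i a 0 x.
Proof.
apply/rowP => k; rewrite !(squeezeE, mxE) /=; case: eqVneq => _ //=; ring.
Qed.

Lemma squeeze_continuous i a :
  continuous (fun z : V * R => squeeze i a z.2 z.1).
Proof.
move=> z; apply: (@continuousD _ _ _ (fun z : V * R => z.1)
  (fun z : V * R => ((1 - z.2) * (a - z.1 0 i)) *: (delta_mx 0 i : V))).
  exact: cvg_fst.
apply: (@continuous_comp _ _ _ (fun z : V * R => (1 - z.2) * (a - z.1 0 i))
  (fun r : R => r *: (delta_mx 0 i : V))); last exact: scalel_continuous.
apply: (@continuousM _ _ (fun z : V * R => 1 - z.2)
  (fun z : V * R => a - z.1 0 i)).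
  apply: (@continuousB _ R^o _ (cst 1) (fun z : V * R => z.2)).
    exact: cst_continuous.
  exact: cvg_snd.
apply: (@continuousB _ R^o _ (cst a) (fun z : V * R => z.1 0 i)).
  exact: cst_continuous.
apply: (@continuous_comp _ _ _ (fun z : V * R => z.1) (fun x : V => x 0 i)).
  exact: cvg_fst.
exact: coord_continuous.
Qed.

Lemma squeeze_is_derive i a t h j x :
  derivable h (squeeze i a t x) (delta_mx 0 j) ->
  is_derive x (delta_mx 0 j) (fun y => h (squeeze i a t y) : R^o)
    (t ^+ (j == i) * partial j h (squeeze i a t x)).
Proof.
move=> dh; rewrite -[x]add0r -(scale0r (delta_mx 0 j)).
apply/(is_derive_lineP (fun y => h (squeeze i a t y) : R^o)).
under eq_fun do rewrite squeeze_shift.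
rewrite squeeze_shift; apply: is_derive_line.
by rewrite mul0r scale0r add0r.
Qed.

(** The weight [t ^+ k] is there because each derivative along [i] under the integral produces a
    factor [t]; with all [k] allowed, the family is closed under partial derivatives. *)
Definition avg i a k h x : R^o := uint (fun t => t ^+ k * h (squeeze i a t x)).

Lemma avg_continuous_integrand i a k h : continuous h ->
  continuous (fun z : V * R => z.2 ^+ k * h (squeeze i a z.2 z.1)).
Proof.
move=> ch z; apply: (@continuousM _ _ (fun z : V * R => z.2 ^+ k)
  (fun z : V * R => h (squeeze i a z.2 z.1))).
  apply: (@continuous_comp _ _ _ (fun z : V * R => z.2) (fun t : R => t ^+ k)).
    exact: cvg_snd.
  exact: exprn_continuous.
apply: (@continuous_comp _ _ _ (fun z : V * R => squeeze i a z.2 z.1) h).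
  exact: squeeze_continuous.
exact: ch.
Qed.

Lemma avg_Ck i a m k h : Ck m setT h -> Ck m setT (avg i a k h).
Proof.
elim: m k h => [|m IH] k h [ch dh].
  split=> // x _; apply: continuous_uint.
  by apply: avg_continuous_integrand => y; exact: ch.
have ch' : continuous h by move=> y; exact: ch.
split=> [x _|j].
  by apply: continuous_uint; exact: avg_continuous_integrand.
have [dj Cj] := dh j.
have cj : continuous (partial j h).
  by move=> y; case: (m) Cj => [|?] [+ _]; exact.
have D x : is_derive x (delta_mx 0 j) (avg i a k h)
    (avg i a (k + (j == i)) (partial j h) x).
  apply: (is_derive_uint x (F := fun x t => t ^+ k * h (squeeze i a t x))
    (F' := fun x t => t ^+ (k + (j == i)) * partial j h (squeeze i a t x))).
  - exact: avg_continuous_integrand.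
  - exact: avg_continuous_integrand.
  move=> y t; rewrite exprD -mulrA.
  apply: is_deriveZ; apply: squeeze_is_derive.
  exact: dj.
split=> [x _|]; first by have [] := D x.
apply: Ck_ext (IH (k + (j == i))%N _ Cj); first exact: openT.
by move=> x _; have [_ <-] := D x.
Qed.

Lemma Ck_squeeze i a t m h : Ck m setT h -> Ck m setT (h \o squeeze i a t).
Proof.
have cs x : continuous_at x (squeeze i a t).
  apply: (@continuous_comp _ _ _ (fun y : V => (y, t))
    (fun z => squeeze i a z.2 z.1)).
    rewrite /prop_for.
    exact: (@cvg_pair V V R (nbhs x) (nbhs x) (nbhs t) _ _ _ id (cst t)
      (@cvg_id _ (nbhs x)) (cvg_cst _)).
  exact: squeeze_continuous.
elim: m h => [|m IH] h [ch dh].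
  by split=> // x _; apply: continuous_comp; [exact: cs|exact: ch].
split=> [x _|j]; first by apply: continuous_comp; [exact: cs|exact: ch].
have [dj Cj] := dh j.
have D x : is_derive x (delta_mx 0 j) (h \o squeeze i a t)
    (t ^+ (j == i) * partial j h (squeeze i a t x)).
  exact/squeeze_is_derive/dj.
split=> [x _|]; first by have [] := D x.
apply: Ck_ext (CkM _ (Ck_cst _ (t ^+ (j == i) : R^o) _) (IH _ Cj));
  try exact: openT.
by move=> x _; have [_ E] := D x; rewrite /partial E.
Qed.

(** The fundamental theorem of calculus along the segment [squeeze i a t x], which reaches [x] at
    time 1 and has velocity [x 0 i - a] along the [i]-th axis. *)
Lemma squeeze0_FTC i a h x : Ck 1 setT h ->
  h x - h (squeeze i a 0 x) = (x 0 i - a) * avg i a 0 (partial i h) x.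
Proof.
move=> [ch /(_ i) [dh [c_dh _]]].
have c_dh' : continuous (partial i h) by move=> y; exact: c_dh.
have cI := continuous_slice
  (F := fun y t => t ^+ 0 * partial i h (squeeze i a t y)) (x := x)
  (avg_continuous_integrand (i := i) (a := a) (k := 0) c_dh').
have D (t : R) : is_derive t 1 (fun t => h (squeeze i a t x) : R)
    ((x 0 i - a) * (t ^+ 0 * partial i h (squeeze i a t x))).
  rewrite expr0 mul1r; under eq_fun do rewrite squeeze_line.
  by rewrite [squeeze i a t x]squeeze_line; apply: is_derive_line; exact: dh.
rewrite /avg -uintZ// (uint_FTC _ D) ?squeeze1// => t.
exact: (@continuousM _ _ (cst (x 0 i - a)) _ t (cvg_cst _) (cI t)).
Qed.

(** The usual straight segment from [p] to [x] is replaced by a path that moves one coordinate at a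
    time, so that only partial derivatives and a one-variable chain rule occur. *)
Lemma hadamard (f : V -> R^o) (p : V) : smooth_on setT f ->
  exists2 g : 'I_n -> V -> R^o, (forall i, smooth_on setT (g i)) &
    forall x, f x = f p + \sum_i (x 0 i - p 0 i) * g i x.
Proof.
move=> fS.
(* [proj s] freezes the coordinates listed in [s] at their values in [p]. Over the full enumeration
   it is the constant [p]; the induction runs on the list. *)
pose proj (s : seq 'I_n) x := foldr (fun i => squeeze i (p 0 i) 0) x s.
suff [g gS gE] :
    exists2 g : 'I_n -> V -> R^o, (forall i, smooth_on setT (g i)) &
    forall x, f x - f (proj (enum 'I_n) x) = \sum_i (x 0 i - p 0 i) * g i x.
  exists g => // x; rewrite -gE.
  suff -> : proj (enum 'I_n) x = p by rewrite addrC subrK.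
  have H s j : proj s x 0 j = if j \in s then p 0 j else x 0 j.
    elim: s => [|i s IH] //=; rewrite squeezeE in_cons IH mul0r addr0.
    by case: eqVneq => [->|].
  by apply/rowP => j; rewrite H mem_enum.
elim: (enum 'I_n) f fS => [|i s IH] f fS /=.
  exists (fun _ => cst 0) => [i k|x]; first exact/Ck_cst/openT.
  by rewrite subrr big1// => i _; rewrite mulr0.
have [g gS gE] :=
  IH (f \o squeeze i (p 0 i) 0) (fun k => Ck_squeeze _ _ _ (fS k)).
(* Only the [i]-th quotient changes. The new average is added to [g i] instead of replacing it,
   since [i] may occur again in the tail [s]. *)
exists (fun j =>
  g j + (if j == i then avg i (p 0 i) 0 (partial i f) else cst 0)).
  move=> j k; apply: CkD; [exact: openT|exact: gS|].
  case: ifP => _; last exact/Ck_cst/openT.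
  by apply: avg_Ck; have [_ /(_ i)[]] := fS k.+1.
move=> x; rewrite -[LHS](subrKA (f (squeeze i (p 0 i) 0 x))).
rewrite squeeze0_FTC; last exact: (fS 1).
rewrite [X in _ + X]gE.
under eq_bigr do rewrite mulrDr.
rewrite big_split /= addrC; congr (_ + _).
rewrite (bigD1 i)//= eqxx big1 ?addr0// => j /negPf ->.
by rewrite mulr0.
Qed.

End Hadamard.

(** * Euclidean space as a manifold *)

Section EuclideanSpace.
Context (R : realType) (n : nat).
Local Notation V := 'rV[R]_n.

Lemma rV_second_countable : @second_countable V.
Proof.
(* The countable base consists of the balls with rational centres and radii [1 / (k + 1)]. *)
pose b (q : 'rV[rat]_n * nat) : set V :=
  ball (map_mx ratr q.1 : V) q.2.+1%:R^-1.
exists [set b q | q in setT].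
  exact: sub_countable (card_image_le _ _) (countableP _).
split=> [_ [q _ <-]|x U].
  by apply: ball_open; rewrite invr_gt0.
move=> /nbhs_ballP [e /= e0 xU].
have e20 : 0 < e / 2 by rewrite divr_gt0.
have [k ke] : exists k : nat, k.+1%:R^-1 < e / 2 :> R.
  by have [k] := ltr_add_invr e20; rewrite add0r; exists k.
have d0 : 0 < k.+1%:R^-1 :> R by rewrite invr_gt0.
have H j : exists q : rat, `|x 0 j - ratr q| < k.+1%:R^-1.
  move: d0; move: (_^-1) => d d0.
  have [|q] := @rat_in_itvoo R (x 0 j - d) (x 0 j + d).
    by lra.
  by rewrite in_itv/= => /andP[h1 h2]; exists q; rewrite ltr_norml; lra.
have [q Hq] := choice H.
have xq : ball (map_mx ratr (\row_j q j) : V) k.+1%:R^-1 x.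
  split=> // i j; rewrite !mxE ord1 /ball /= distrC; exact: Hq.
exists (b (\row_j q j, k)).
  by split=> //; exists (\row_j q j, k).
move=> y /= qy; apply: xU; rewrite [e]splitr.
apply: (@ball_triangle _ _ (map_mx ratr (\row_j q j) : V)).
  by apply/ball_sym; apply: le_ball xq; exact: ltW.
by apply: le_ball qy; exact: ltW.
Qed.

Lemma Ck_id k (U : set V) : open U -> Ck k U (id : V -> V).
Proof.
move=> oU; case: k => [|k]; first by split=> // x _; exact: cvg_id.
split=> [x _|i]; first exact: cvg_id.
split=> [x _|]; first exact: derivable_id.
apply: (Ck_ext oU _ (Ck_cst k (delta_mx 0 i : V) oU)) => x _.
by rewrite /partial derive_id.
Qed.

Lemma id_setT_open : open (id @` [set: V]).
Proof. by rewrite image_id; exact: openT. Qed.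

Definition id_chart : chart R n V :=
  @Chart R n V setT id id openT id_setT_open
    (fun _ _ => erefl) (fun _ _ => cvg_id) (fun _ _ => cvg_id).

Lemma euclidean_cover (p : V) : exists2 c, [set id_chart] c & cdom c p.
Proof. by exists id_chart. Qed.

Lemma euclidean_compat (c d : chart R n V) :
  [set id_chart] c -> [set id_chart] d -> transition_smooth c d.
Proof.
move=> -> -> k; apply: Ck_id => /=.
by rewrite setTI; exact: id_setT_open.
Qed.

Definition euclidean : manifold R n :=
  @Manifold R n V (@norm_hausdorff _ V) rV_second_countable [set id_chart]
    euclidean_cover euclidean_compat.

Local Notation M := euclidean.
Local Notation A := (cinfty M).

Lemma smooth_funE (f : M -> R^o) :
  (f \in @smooth_fun R n M) <-> smooth_on setT (f : V -> R^o).
Proof.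
split=> [/asboolP/(_ id_chart erefl)|fS].
  by rewrite /cimg /= image_id.
by apply/asboolP => _ ->; rewrite /cimg /= image_id.
Qed.

Lemma cinfty_smooth_on (f : A) : smooth_on setT (f : V -> R^o).
Proof. exact/smooth_funE/cinfty_smooth. Qed.

Lemma is_derive_coord (x v : V) i :
  is_derive x v (fun x : V => x 0 i : R^o) (v 0 i).
Proof.
rewrite -[x]add0r -(scale0r v).
apply/(is_derive_lineP (fun x : V => x 0 i : R^o)).
have := is_deriveD (is_deriveZ (v 0 i) (is_derive_id (0 : R) (1 : R)))
  (is_derive_cst (x 0 i) (0 : R) 1).
rewrite addr0 [_ *: 1]mulr1; congr (is_derive _ _ _ _).
by apply/funext => r; rewrite /= !mxE mulrC.
Qed.

Lemma smooth_coord i : smooth_on setT (fun x : V => x 0 i : R^o).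
Proof.
case=> [|k]; first by split=> // x _; exact: coord_continuous.
split=> [x _|j]; first exact: coord_continuous.
split=> [x _|]; first by have [] := is_derive_coord x (delta_mx 0 j) i.
apply: (Ck_ext openT _ (Ck_cst k ((delta_mx 0 j : V) 0 i : R^o) openT)) => x _.
by have [_ E] := is_derive_coord x (delta_mx 0 j) i; rewrite /partial E.
Qed.

Definition xcoord i : A := Cinfty (iffRL (smooth_funE _) (smooth_coord i)).

Lemma smooth_partial i (f : A) : smooth_on setT (partial i (f : V -> R^o)).
Proof. by move=> k; have [_ /(_ i)[]] := cinfty_smooth_on f k.+1. Qed.

Definition pderiv i (f : A) : A^o :=
  Cinfty (iffRL (smooth_funE _) (smooth_partial i f)).

Lemma pderiv_der i : pderiv i \in @derivation R n M.
Proof.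
have df (f : A) (x : V) : derivable (f : V -> R^o) x (delta_mx 0 i).
  by have [_ /(_ i)[+ _]] := cinfty_smooth_on f 1; apply.
apply/asboolP; split=> [a f g|f g]; apply/val_inj/funext => x /=.
  transitivity
    ('D_(delta_mx 0 i) (a *: (f : V -> R^o) + (g : V -> R^o)) x) => //.
  by rewrite deriveD ?deriveZ//; exact: derivableZ.
transitivity ('D_(delta_mx 0 i) ((f : V -> R^o) * (g : V -> R^o)) x) => //.
by rewrite deriveM.
Qed.

Definition pfield i : vfield M := Vfield (pderiv_der i).

Lemma pfield_coord i j : pfield i (xcoord j) = (i == j)%:R.
Proof.
apply/val_inj/funext => x /=.
rewrite /partial; have [_ ->] := is_derive_coord x (delta_mx 0 i) j.
by rewrite mxE eqxx eq_sym; case: (i == j).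
Qed.

End EuclideanSpace.

(** * Algebra of derivations, at a point and global *)

Section Derivations.
Context (R : realType) (n : nat) (M : manifold R n).
Local Notation A := (cinfty M).

Section AtPoint.
Context (p : M) (u : tangent p).

Lemma tangentD (f g : A) : u (f + g) = u f + u g.
Proof.
have /asboolP[uL _] := tangent_der u.
by have := uL 1 f g; rewrite scale1r mul1r.
Qed.

Lemma tangent0 : u 0 = 0.
Proof. by apply: (@addrI _ (u 0)); rewrite -tangentD !addr0. Qed.

Lemma tangentZ a (f : A) : u (a *: f) = a * u f.
Proof.
have /asboolP[uL _] := tangent_der u.
by have := uL a f 0; rewrite tangent0 !addr0.
Qed.

Lemma tangentM (f g : A) : u (f * g) = f p * u g + g p * u f.
Proof. by have /asboolP[_ uM] := tangent_der u. Qed.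

(** The product rule for [1 * 1] gives [u 1 + u 1 = u 1]. *)
Lemma tangent1 : u 1 = 0.
Proof.
have E1 : (1 : A) p = 1 by [].
apply: (@addrI _ (u 1)); have := tangentM 1 1.
by rewrite !mulr1 E1 !mul1r addr0 => <-.
Qed.

Lemma tangent_sum (I : finType) (F : I -> A) : u (\sum_i F i) = \sum_i u (F i).
Proof.
by apply: (big_morph _ tangentD tangent0).
Qed.

End AtPoint.

Lemma tangent_addE (p : M) (u v : tangent p) (f : A) : (u + v) f = u f + v f.
Proof. by []. Qed.

Lemma tangent_scaleE (p : M) a (u : tangent p) (f : A) : (a *: u) f = a * u f.
Proof. by []. Qed.

Lemma tangent_sumE (p : M) (I : finType) (F : I -> tangent p) (f : A) :
  (\sum_i F i) f = \sum_i F i f.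
Proof. by apply: (big_morph (fun u : tangent p => u f)). Qed.

Lemma tangent_eq (p : M) (u v : tangent p) : (forall f, u f = v f) -> u = v.
Proof. by move=> uv; apply/val_inj/funext. Qed.

Section Field.
Context (X : vfield M).

Lemma vfieldD (f g : A) : X (f + g) = (X f : A) + X g.
Proof.
have /asboolP[uL _] := vfield_der X.
by have := uL 1 f g; rewrite !scale1r.
Qed.

Lemma vfield0 : X 0 = 0.
Proof. by apply: (@addrI _ (X 0 : A)); rewrite -vfieldD !addr0. Qed.

Lemma vfieldZ a (f : A) : X (a *: f) = a *: (X f : A).
Proof.
have /asboolP[uL _] := vfield_der X.
by have := uL a f 0; rewrite vfield0 !addr0.
Qed.

Lemma vfieldM (f g : A) : X (f * g) = f * X g + g * X f.
Proof. by have /asboolP[_ uM] := vfield_der X. Qed.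

Lemma vfield_sum (I : finType) (F : I -> A) :
  X (\sum_i F i) = \sum_i (X (F i) : A).
Proof. by apply: (big_morph _ vfieldD vfield0). Qed.

End Field.

Lemma vfield_scaleE (h : A) (X : vfield M) f : (h *: X) f = h * X f.
Proof. by []. Qed.

Lemma vfield_sumE (I : finType) (F : I -> vfield M) (f : A) :
  (\sum_i F i) f = \sum_i (F i f : A).
Proof. by apply: (big_morph (fun X : vfield M => X f : A)). Qed.

Lemma cinfty_eq (f g : A) : (forall p, f p = g p) -> f = g.
Proof. by move=> fg; apply/val_inj/funext. Qed.

Lemma cinfty_addE (f g : A) p : (f + g) p = f p + g p. Proof. by []. Qed.

Lemma cinfty_oppE (f : A) p : (- f) p = - f p. Proof. by []. Qed.

Lemma cinfty_mulE (f g : A) p : (f * g) p = f p * g p. Proof. by []. Qed.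

Lemma cinfty_scaleE a (f : A) p : (a *: f) p = a * f p. Proof. by []. Qed.

Lemma cinfty_oneE p : (1 : A) p = 1. Proof. by []. Qed.

Lemma vf_atE p (X : vfield M) f : vf_at p X f = (X f : A) p. Proof. by []. Qed.

Lemma cinfty_sumE (I : finType) (F : I -> A) (p : M) :
  (\sum_i F i) p = \sum_i F i p :> R.
Proof. by apply: (big_morph (fun f : A => f p : R)). Qed.

End Derivations.

(** * Coordinates of tangent vectors and vector fields *)

Section EuclideanDerivations.
Context (R : realType) (n : nat).
Local Notation M := (euclidean R n).
Local Notation A := (cinfty M).

Lemma cinfty_hadamard (f : A) (p : M) : exists g : 'I_n -> A,
  f = f p *: (1 : A) + \sum_i (xcoord R i - p 0 i *: (1 : A)) * g i.
Proof.
have [g gS gE] := hadamard p (cinfty_smooth_on f).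
exists (fun i => Cinfty (iffRL (smooth_funE _) (gS i))).
apply: cinfty_eq => x.
rewrite cinfty_addE cinfty_scaleE cinfty_oneE mulr1 cinfty_sumE gE.
congr (_ + _); apply: eq_bigr => i _.
by rewrite cinfty_mulE cinfty_addE cinfty_oppE cinfty_scaleE cinfty_oneE mulr1.
Qed.

(** A derivation kills the constant in Hadamard's formula, and each factor [x_i - p_i] vanishes at
    [p], so the product rule keeps only the derivative of that factor times [g i p]. *)
Lemma tangentE (p : M) (u : tangent p) f :
  u f = \sum_i u (xcoord R i) * (pfield R i f : A) p.
Proof.
have [g fE] := cinfty_hadamard f p.
(* The functions [g] do not depend on [v]; taking the coordinate vectors for [v] identifies [g i p]
   with the partial derivatives of [f]. *)
have H (v : tangent p) : v f = \sum_i v (xcoord R i) * g i p.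
  rewrite [in LHS]fE tangentD tangentZ tangent1 mulr0 add0r tangent_sum.
  apply: eq_bigr => i _.
  rewrite tangentM tangentD -scaleN1r !tangentZ tangent1 !mulr0 addr0.
  rewrite cinfty_addE !cinfty_scaleE cinfty_oneE.
  have -> : (xcoord R i : A) p = p 0 i by [].
  ring.
rewrite H; apply: eq_bigr => i _; congr (_ * _).
rewrite -vf_atE H (bigD1 i)// big1 => [|j ji].
  by rewrite vf_atE pfield_coord eqxx mul1r [RHS]addr0.
by rewrite vf_atE pfield_coord eq_sym (negPf ji) mul0r.
Qed.

Lemma tangentP (p : M) (u v : tangent p) :
  (forall i, u (xcoord R i) = v (xcoord R i)) -> u = v.
Proof.
move=> uv; apply: tangent_eq => f; rewrite (tangentE u) (tangentE v).
by apply: eq_bigr => i _; rewrite uv.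
Qed.

Lemma vfieldP (X Y : vfield M) :
  (forall i, X (xcoord R i) = Y (xcoord R i)) -> X = Y.
Proof.
move=> XY; apply/val_inj/funext => f; apply: cinfty_eq => p.
suff E : vf_at p X = vf_at p Y by rewrite -[LHS](vf_atE p X) E.
by apply: tangentP => i; rewrite !vf_atE XY.
Qed.

Definition vf_of (c : 'I_n -> A) : vfield M := \sum_i c i *: pfield R i.

Lemma vf_ofE c i : vf_of c (xcoord R i) = c i.
Proof.
rewrite vfield_sumE (bigD1 i)// big1 => [|j ji].
  by rewrite vfield_scaleE pfield_coord eqxx mulr1 [LHS]addr0.
by rewrite vfield_scaleE pfield_coord (negPf ji) mulr0.
Qed.

Definition tan_of (p : M) (c : 'I_n -> R) : tangent p :=
  \sum_i c i *: vf_at p (pfield R i).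

Lemma tan_ofE p c i : tan_of p c (xcoord R i) = c i.
Proof.
rewrite tangent_sumE (bigD1 i)// big1 => [|j ji].
  by rewrite tangent_scaleE vf_atE pfield_coord eqxx mulr1 [LHS]addr0.
by rewrite tangent_scaleE vf_atE pfield_coord (negPf ji) mulr0.
Qed.

(** An extension exists, namely the field with constant components, so [xget] does not fall back on
    its default 0. *)
Lemma extensionK (p : M) (u : tangent p) : vf_at p (extension u) = u.
Proof.
pose X := vf_of (fun i => u (xcoord R i) *: (1 : A)).
rewrite /extension; case: xgetP => // /(_ X) [].
apply: tangentP => i; rewrite vf_atE vf_ofE cinfty_scaleE.
exact: mulr1.
Qed.

End EuclideanDerivations.

(** * Linear algebra of the model *)

Section ComplexStructure.
Context (R : realFieldType) (V : vectType R) (J : 'End(V)).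
Hypothesis JJ : forall x, J (J x) = - x.

(** A vector outside the [J]-stable span [W] of the pairs found so far is added together with its
    image under [J]; the bound on the dimension provides such a vector. *)
Lemma adapted_free k : (k + k <= \dim {:V})%N ->
  exists2 s : seq V, size s = k & free (s ++ map J s).
Proof.
elim: k => [|k IH] km; first by exists [::] => //; rewrite nil_free.
have [|s sk fs] := IH; first by apply: leq_trans km; rewrite addnS addSn !leqW.
set W := <<(s ++ map J s)>>%VS.
have JW w : w \in W -> J w \in W.
  move=> wW; have /subvP : (J @: W <= W)%VS.
    rewrite limg_span map_cat span_cat subv_add; apply/andP; split.
      by rewrite /W span_cat addvSr.
    apply/span_subvP => _ /mapP[_ /mapP[x xs ->] ->].
    by rewrite JJ rpredN memv_span// mem_cat xs.
  by apply; rewrite memv_img.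
have [v _ vW] : exists2 v, v \in {:V}%VS & v \notin W.
  apply/subvPn; apply: contraL km => /dimvS.
  rewrite (eqP fs) size_cat size_map sk -ltnNge => h.
  by rewrite addnS addSn ltnS; exact: leqW.
exists (v :: s); first by rewrite /= sk.
have : perm_eq ((v :: s) ++ map J (v :: s)) (v :: J v :: s ++ map J s).
  by rewrite /= perm_cons perm_catC /= perm_cons perm_catC.
move=> /perm_free ->; rewrite !free_cons fs andbT.
apply/andP; split; last first.
  by apply: contra vW => /JW; rewrite JJ rpredN.
(* If [v = a *: J v + w], applying [J] and eliminating [J v] gives
   [(1 + a ^+ 2) *: v = a *: J w + w], an element of [W]; the factor is positive. *)
rewrite span_cons; apply: contra vW => /memv_addP[_ /vlineP[a ->] [w wW vE]].
have a0 : 1 + a ^+ 2 != 0 by rewrite gt_eqF// ltr_wpDr ?sqr_ge0.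
suff : (1 + a ^+ 2) *: v \in W.
  by move=> /(memvZ (1 + a ^+ 2)^-1); rewrite scalerA mulVf ?scale1r.
have -> : (1 + a ^+ 2) *: v = a *: J w + w.
  have JvE : J v = J w - a *: v.
    rewrite {1}vE linearD linearZ /=.
    by rewrite JJ scalerN addrC.
  by rewrite scalerDl scale1r {1}vE JvE scalerBr scalerA expr2 addrAC subrK.
by rewrite memvD ?memvZ ?JW.
Qed.

Lemma adapted_basis m : \dim {:V} = (m + m)%N ->
  exists b : (m + m).-tuple V, basis_of fullv b /\
    forall i : 'I_m, J b`_(lshift m i) = b`_(rshift m i).
Proof.
move=> dimV; have [|s sm fs] := @adapted_free m; first by rewrite dimV.
have sz : size (s ++ map J s) == (m + m)%N by rewrite size_cat size_map sm.
exists (Tuple sz); split.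
  by rewrite basisEfree fs subvf dimV (eqP sz) leqnn.
move=> i /=; rewrite !nth_cat sm ltn_ord ltnNge leq_addr addKn /=.
by rewrite (nth_map 0) ?sm.
Qed.

(** Testing on linear functionals turns vector identities into scalar ones, within reach of [ring]
    and [lra]. *)
Lemma eq_by_functionals (u v : V) :
  (forall phi : {scalar V}, phi u = phi v) -> u = v.
Proof.
move=> uv; rewrite (coord_vbasis (memvf u)) (coord_vbasis (memvf v)).
by apply: eq_bigr => i _; congr (_ *: _); exact: uv.
Qed.

End ComplexStructure.

(** * A trilinear map whose antisymmetrization is the given curvature *)

Section CurvatureModel.
Context (R : realFieldType) (V : vectType R) (J : V -> V).
Context (A : V -> V -> V -> V).
Hypothesis J_lin : forall c x x', J (c *: x + x') = c *: J x + J x'.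
Hypothesis A_lin1 : forall c x x' y z,
  A (c *: x + x') y z = c *: A x y z + A x' y z.
Hypothesis A_lin2 : forall c x y y' z,
  A x (c *: y + y') z = c *: A x y z + A x y' z.
Hypothesis A_lin3 : forall c x y z z',
  A x y (c *: z + z') = c *: A x y z + A x y z'.
Hypothesis JJ : forall x, J (J x) = - x.
Hypothesis A_skew : forall x y z, A x y z = - A y x z.
Hypothesis A_bianchi : forall x y z, A x y z + A y z x + A z x y = 0.
Hypothesis A_kaehler : forall x y z, A x y (J z) = J (A x y z).

(* [S] plus a third of [Q(w, y) z + Q(w, z) y], in the notation of the header. *)
Definition christoffel (w y z : V) : V :=
  4^-1 *: (A w y z + J (A (J w) y z) - J (A w (J y) z) + A (J w) (J y) z) +
  6^-1 *: ((A w y z - A (J w) (J y) z) + (A w z y - A (J w) (J z) y)).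

Let linD (f : V -> V) : (forall c x x', f (c *: x + x') = c *: f x + f x') ->
  forall x y, f (x + y) = f x + f y.
Proof. by move=> fl x y; have := fl 1 x y; rewrite !scale1r. Qed.

Let lin0 (f : V -> V) : (forall c x x', f (c *: x + x') = c *: f x + f x') ->
  f 0 = 0.
Proof.
by move=> fl; apply: (@addrI _ (f 0)); rewrite -(linD fl) !addr0.
Qed.

Let linZ (f : V -> V) : (forall c x x', f (c *: x + x') = c *: f x + f x') ->
  forall c x, f (c *: x) = c *: f x.
Proof. by move=> fl c x; have := fl c x 0; rewrite (lin0 fl) !addr0. Qed.

Let linN (f : V -> V) : (forall c x x', f (c *: x + x') = c *: f x + f x') ->
  forall x, f (- x) = - f x.
Proof. by move=> fl x; rewrite -scaleN1r (linZ fl) scaleN1r. Qed.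

Let J0 := lin0 J_lin.
Let JD := linD J_lin.
Let JN := linN J_lin.
Let JZ := linZ J_lin.
Let AN1 x y z : A (- x) y z = - A x y z.
Proof. exact: (linN (fun c x x' => A_lin1 c x x' y z)). Qed.
Let AN2 x y z : A x (- y) z = - A x y z.
Proof. exact: (linN (fun c y y' => A_lin2 c x y y' z)). Qed.

Section Functional.
Context (phi : {scalar V}).

Let phiD x y : phi (x + y) = phi x + phi y. Proof. exact: linearD. Qed.
Let phiN x : phi (- x) = - phi x. Proof. exact: linearN. Qed.
Let phiZ a x : phi (a *: x) = a * phi x. Proof. exact: linearZ. Qed.
Let phi0 : phi 0 = 0. Proof. exact: linear0. Qed.

(** Rewriting with these rules moves [J] out of the last argument of [A] and reduces double [J].
    Skew-symmetry would loop as a rewrite rule, so [phi_skew] and [phi_skewJ] supply it at chosen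
    arguments. *)
Definition phi_lin := (A_lin1, A_lin2, A_lin3, AN1, AN2, JD, JN, JZ, J0,
  A_kaehler, JJ, phiD, phiN, phiZ, phi0).

Lemma phi_skew x y z : phi (A x y z) = - phi (A y x z).
Proof. by rewrite A_skew phiN. Qed.

Lemma phi_skewJ x y z : phi (J (A x y z)) = - phi (J (A y x z)).
Proof. by rewrite A_skew JN phiN. Qed.

End Functional.

Lemma christoffel_linear1 a w w' y z :
  christoffel (a *: w + w') y z = a *: christoffel w y z + christoffel w' y z.
Proof.
apply: eq_by_functionals => phi; rewrite /christoffel J_lin !phi_lin; ring.
Qed.

Lemma christoffel_linear2 a w y y' z :
  christoffel w (a *: y + y') z = a *: christoffel w y z + christoffel w y' z.
Proof.
apply: eq_by_functionals => phi; rewrite /christoffel J_lin !phi_lin; ring.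
Qed.

(** This is the vanishing of the (0,2) part. Take the Bianchi identity at (x, y, z), minus that at
    (Jx, Jy, z), plus [J] of those at (Jx, y, z) and (x, Jy, z): the terms without [z] in the last
    argument cancel by [A_kaehler]. *)
Lemma bianchi_J x y z :
  J (A (J x) y z) + J (A x (J y) z) = A (J x) (J y) z - A x y z.
Proof.
apply: eq_by_functionals => phi.
have := congr1 phi (A_bianchi x y z).
have := congr1 phi (A_bianchi (J x) (J y) z).
have := congr1 phi (congr1 J (A_bianchi (J x) y z)).
have := congr1 phi (congr1 J (A_bianchi x (J y) z)).
rewrite !phi_lin; lra.
Qed.

(** The part with [6^-1] is symmetric as written. By [bianchi_J] the other part is half of
    [A w y z + J (A (J w) y z)], and the Bianchi identity turns its antisymmetrization in (y, z)
    into half of [- A y z w - J (A y z (J w))], which is 0. *)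
Lemma christoffel_sym w y z : christoffel w y z = christoffel w z y.
Proof.
apply: eq_by_functionals => phi; rewrite /christoffel.
have := congr1 phi (bianchi_J w y z).
have := congr1 phi (bianchi_J w z y).
have := congr1 phi (A_bianchi w y z).
have := congr1 phi (congr1 J (A_bianchi (J w) y z)).
rewrite !phi_lin.
have := phi_skew phi w z y; have := phi_skew phi y z w.
have := phi_skewJ phi (J w) z y; lra.
Qed.

Lemma christoffel_linear3 a w y z z' :
  christoffel w y (a *: z + z') = a *: christoffel w y z + christoffel w y z'.
Proof. by rewrite ![christoffel w y _]christoffel_sym christoffel_linear2. Qed.

(** Only [A w z y - A (J w) (J z) y] has [z] outside the last argument of [A], and it is complex
    linear in [z] by [bianchi_J]. *)
Lemma christoffel_J w y z : christoffel w y (J z) = J (christoffel w y z).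
Proof.
apply: eq_by_functionals => phi; rewrite /christoffel.
have := congr1 phi (congr1 J (bianchi_J w z y)).
rewrite !phi_lin; lra.
Qed.

(** In the part with [4^-1] the terms with an outer [J] cancel and the (1,1) part of [A] remains.
    The rest is a third of [2 Q(x, y) z + Q(x, z) y - Q(y, z) x], which is [Q(x, y) z] by the
    Bianchi identity for the (2,0) part [Q]. *)
Lemma christoffel_curvature x y z :
  christoffel x y z - christoffel y x z = A x y z.
Proof.
apply: eq_by_functionals => phi; rewrite /christoffel.
have := congr1 phi (bianchi_J x y z).
have := congr1 phi (A_bianchi x y z).
have := congr1 phi (congr1 J (A_bianchi x y (J z))).
have := congr1 phi (A_bianchi (J x) y (J z)).
have := congr1 phi (A_bianchi x (J y) (J z)).
rewrite !phi_lin.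
have := phi_skew phi y x z; have := phi_skew phi (J y) (J x) z.
have := phi_skew phi z x y; have := phi_skew phi (J z) (J x) y.
have := phi_skewJ phi (J y) x z; have := phi_skewJ phi y (J x) z.
lra.
Qed.

End CurvatureModel.

(** * Connections with linear Christoffel symbols *)

Section Model.
Context (R : realType) (n : nat) (V : vectType R) (b : n.-tuple V).
Hypothesis bP : basis_of fullv b.
Local Notation M := (euclidean R n).
Local Notation A := (cinfty M).

Definition vec (c : 'I_n -> R) : V := \sum_i c i *: b`_i.

Lemma coord_vec c i : coord b i (vec c) = c i.
Proof. exact: coord_sum_free (basis_free bP). Qed.

Lemma vec_coord x : vec (fun i => coord b i x) = x.
Proof. exact/esym/(coord_basis bP (memvf x)). Qed.

Lemma vecP (x y : V) :
  (forall i, coord b i x = coord b i y) -> x = y.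
Proof.
move=> xy; rewrite -[x]vec_coord -[y]vec_coord.
by apply: eq_bigr => i _; rewrite xy.
Qed.

Lemma vec_linear a c d : vec (fun i => a * c i + d i) = a *: vec c + vec d.
Proof.
rewrite /vec scaler_sumr -big_split; apply: eq_bigr => i _.
by rewrite scalerDl scalerA.
Qed.

Lemma vecZ a c : vec (fun i => a * c i) = a *: vec c.
Proof.
by rewrite /vec scaler_sumr; apply: eq_bigr => i _; rewrite scalerA.
Qed.

Lemma vec_eq c d : c =1 d -> vec c = vec d.
Proof. by move=> cd; apply: eq_bigr => i _; rewrite cd. Qed.

Definition tan_vec (p : M) (u : tangent p) : V := vec (fun i => u (xcoord R i)).

Lemma tan_vec_linear p : linear (@tan_vec p).
Proof.
move=> a u v; rewrite /tan_vec -vec_linear; apply: vec_eq => i.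
by rewrite tangent_addE tangent_scaleE.
Qed.

HB.instance Definition _ p :=
  GRing.isLinear.Build R (tangent p) V _ (@tan_vec p) (@tan_vec_linear p).

Lemma tan_vec_inj p (u v : tangent p) : tan_vec u = tan_vec v -> u = v.
Proof.
move=> uv; apply: tangentP => i.
by rewrite -[LHS](coord_vec (fun i => u (xcoord R i))) [vec _]uv coord_vec.
Qed.

Definition vec_tan (p : M) (x : V) : tangent p :=
  tan_of p (fun i => coord b i x).

Lemma vec_tanK p : cancel (@vec_tan p) (@tan_vec p).
Proof.
move=> x; rewrite -[RHS]vec_coord; apply: vec_eq => i.
by rewrite tan_ofE.
Qed.

Lemma tan_vecK p : cancel (@tan_vec p) (@vec_tan p).
Proof. by move=> u; apply: tan_vec_inj; rewrite vec_tanK. Qed.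

Lemma vec_tan_linear p : linear (@vec_tan p).
Proof.
move=> a x y; apply: tangentP => i.
by rewrite tangent_addE tangent_scaleE !tan_ofE linearP.
Qed.

HB.instance Definition _ p :=
  GRing.isLinear.Build R V (tangent p) _ (@vec_tan p) (@vec_tan_linear p).

Definition vec_at (F : 'I_n -> A) (p : M) : V := vec (fun i => F i p).

Lemma vec_at_eq (F G : 'I_n -> A) :
  (forall p, vec_at F p = vec_at G p) -> forall i, F i = G i.
Proof.
move=> FG i; apply: cinfty_eq => p.
by rewrite -(coord_vec (fun i => F i p)) [vec _]FG coord_vec.
Qed.

Definition comps (X : vfield M) (i : 'I_n) : A := X (xcoord R i).

Lemma tan_vec_at p X : tan_vec (vf_at p X) = vec_at (comps X) p.
Proof. by []. Qed.

(** Reduces identities between fields to identities in [V] at each point, where linearity over [V]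
    applies. *)
Lemma vfield_eq (X Y : vfield M) :
  (forall p, tan_vec (vf_at p X) = tan_vec (vf_at p Y)) -> X = Y.
Proof.
by move=> XY; apply: vfieldP; apply: (@vec_at_eq (comps X) (comps Y)).
Qed.

Lemma tan_vec_vfieldD p (X Y : vfield M) :
  tan_vec (vf_at p (X + Y)) = tan_vec (vf_at p X) + tan_vec (vf_at p Y).
Proof. by rewrite -linearD; congr tan_vec; apply: tangent_eq. Qed.

Lemma tan_vec_vfieldN p (X : vfield M) :
  tan_vec (vf_at p (- X)) = - tan_vec (vf_at p X).
Proof. by rewrite -linearN; congr tan_vec; apply: tangent_eq. Qed.

Lemma tan_vec_vfieldZ p (f : A) (X : vfield M) :
  tan_vec (vf_at p (f *: X)) = f p *: tan_vec (vf_at p X).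
Proof. by rewrite -linearZ; congr tan_vec; apply: tangent_eq. Qed.

(** The flat connection of the coordinates, recorded by its value in [V] at each point. *)
Definition flat_vec (X Y : vfield M) (p : M) : V :=
  vec_at (fun i => X (comps Y i)) p.

Lemma flat_vecDl X Y Z p :
  flat_vec (X + Y) Z p = flat_vec X Z p + flat_vec Y Z p.
Proof.
rewrite -[flat_vec X Z p]scale1r -vec_linear; apply: vec_eq => i.
by rewrite mul1r.
Qed.

Lemma flat_vecDr X Y Z p :
  flat_vec X (Y + Z) p = flat_vec X Y p + flat_vec X Z p.
Proof.
rewrite -[flat_vec X Y p]scale1r -vec_linear; apply: vec_eq => i.
by rewrite mul1r -cinfty_addE -vfieldD.
Qed.

Lemma flat_vecZl (f : A) X Y p : flat_vec (f *: X) Y p = f p *: flat_vec X Y p.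
Proof. by rewrite -vecZ; apply: vec_eq. Qed.

Lemma flat_vecZr (f : A) X Y p :
  flat_vec X (f *: Y) p =
  (X f : A) p *: tan_vec (vf_at p Y) + f p *: flat_vec X Y p.
Proof.
rewrite tan_vec_at /flat_vec /vec_at -(vecZ (f p)) -vec_linear.
apply: vec_eq => i; rewrite -!cinfty_mulE -cinfty_addE addrC.
congr (cinfty_fun _ p); rewrite vfieldM.
by rewrite [X f * _]mulrC.
Qed.

(** * The almost complex structure with constant coefficients *)

Section ConstantEndomorphism.
Context (J : 'End(V)).

Definition end_comps (F : 'I_n -> A) (i : 'I_n) : A :=
  \sum_(j < n) coord b i (J b`_j) *: F j.

Lemma end_compsE F p : vec_at (end_comps F) p = J (vec_at F p).
Proof.
apply: vecP => i; rewrite coord_vec cinfty_sumE /vec_at /vec !linear_sum.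
by apply: eq_bigr => j _; rewrite cinfty_scaleE !linearZ /= mulrC.
Qed.

Definition end_at p (u : tangent p) : tangent p := vec_tan p (J (tan_vec u)).

Lemma end_atE p (u : tangent p) : tan_vec (end_at u) = J (tan_vec u).
Proof. exact: vec_tanK. Qed.

Lemma end_at_linear p : linear (@end_at p).
Proof.
by move=> a u v; rewrite /end_at !linearP.
Qed.

HB.instance Definition _ p :=
  GRing.isLinear.Build R (tangent p) (tangent p) _ (@end_at p)
    (@end_at_linear p).

Definition end_field (X : vfield M) : vfield M := vf_of (end_comps (comps X)).

Lemma end_fieldE p X : vf_at p (end_field X) = end_at (vf_at p X).
Proof.
apply: tan_vec_inj; rewrite end_atE !tan_vec_at -end_compsE.
by apply: vec_eq => i; rewrite /comps vf_ofE.
Qed.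

Hypothesis JJ : forall x, J (J x) = - x.

Lemma end_at_sq p (u : tangent p) : end_at (end_at u) = - u.
Proof.
apply: tan_vec_inj; rewrite !end_atE JJ.
by rewrite linearN.
Qed.

Definition constant_acs : almost_complex M :=
  @AlmostComplex R n M (fun p => @end_at p) end_field end_fieldE end_at_sq.

End ConstantEndomorphism.

(** * The flat connection plus a trilinear term *)

Section LinearConnection.
Context (T : V -> V -> V -> V).
Hypothesis T_lin1 : forall c x x' y z,
  T (c *: x + x') y z = c *: T x y z + T x' y z.
Hypothesis T_lin2 : forall c x y y' z,
  T x (c *: y + y') z = c *: T x y z + T x y' z.
Hypothesis T_lin3 : forall c x y z z',
  T x y (c *: z + z') = c *: T x y z + T x y z'.

(** The expansion over the basis makes the components polynomials in smooth functions, hence smooth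
    by construction. *)
Definition trilinear_comps (W Y Z : 'I_n -> A) (i : 'I_n) : A :=
  \sum_(l < n) \sum_(j < n) \sum_(k < n)
    coord b i (T b`_l b`_j b`_k) *: (W l * (Y j * Z k)).

Lemma multilinear_vec c d e :
  T (vec c) (vec d) (vec e) =
  \sum_(l < n) \sum_(j < n) \sum_(k < n)
    (c l * (d j * e k)) *: T b`_l b`_j b`_k.
Proof.
have lin_vec (f : V -> V) : (forall a x y, f (a *: x + y) = a *: f x + f y) ->
    forall c, f (vec c) = \sum_i c i *: f b`_i.
  move=> fl c'.
  have f0 : f 0 = 0.
    by apply: (@addrI _ (f 0)); have := fl 1 0 0; rewrite !scale1r !addr0.
  rewrite /vec; elim/big_rec2: _ => [|i x y _ <-]; first exact: f0.
  exact: fl.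
rewrite (lin_vec (fun x => T x _ _)) //; apply: eq_bigr => l _.
rewrite (lin_vec (fun x => T _ x _)) // scaler_sumr; apply: eq_bigr => j _.
rewrite (lin_vec (fun x => T _ _ x)) // !scaler_sumr; apply: eq_bigr => k _.
by rewrite !scalerA mulrA.
Qed.

Lemma trilinear_compsE W Y Z p :
  vec_at (trilinear_comps W Y Z) p = T (vec_at W p) (vec_at Y p) (vec_at Z p).
Proof.
apply: vecP => i; rewrite coord_vec /vec_at multilinear_vec.
rewrite cinfty_sumE linear_sum; apply: eq_bigr => l _.
rewrite cinfty_sumE linear_sum; apply: eq_bigr => j _.
rewrite cinfty_sumE linear_sum; apply: eq_bigr => k _.
by rewrite cinfty_scaleE !cinfty_mulE linearZ /= mulrC.
Qed.

(** As [W] vanishes at [p], the product rule keeps only the terms in which [u] falls on [W]. *)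
Lemma trilinear_comps_tangent (p : M) (u : tangent p) (W Y Z : 'I_n -> A) :
  (forall l, W l p = 0) ->
  vec (fun i => u (trilinear_comps W Y Z i)) =
  T (vec (fun l => u (W l))) (vec_at Y p) (vec_at Z p).
Proof.
move=> W0; apply: vecP => i; rewrite coord_vec /vec_at multilinear_vec.
rewrite tangent_sum linear_sum; apply: eq_bigr => l _.
rewrite tangent_sum linear_sum; apply: eq_bigr => j _.
rewrite tangent_sum linear_sum; apply: eq_bigr => k _.
rewrite tangentZ tangentM W0 mul0r add0r cinfty_mulE linearZ /= mulrC.
by rewrite [u _ * _]mulrC.
Qed.

(** The first argument of the trilinear term is the tuple of coordinate functions, that is, the
    position vector. *)
Definition nabla_comps (X Y : vfield M) (i : 'I_n) : A :=
  X (comps Y i) + trilinear_comps (@xcoord R n) (comps X) (comps Y) i.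

Definition nabla_field (X Y : vfield M) : vfield M := vf_of (nabla_comps X Y).

Lemma nabla_vec X Y p :
  tan_vec (vf_at p (nabla_field X Y)) =
  flat_vec X Y p +
  T (vec_at (@xcoord R n) p) (tan_vec (vf_at p X)) (tan_vec (vf_at p Y)).
Proof.
rewrite -trilinear_compsE -[flat_vec X Y p]scale1r -vec_linear.
apply: vec_eq => i.
by rewrite vf_atE vf_ofE cinfty_addE mul1r.
Qed.

Let T_D2 x y y' z : T x (y + y') z = T x y z + T x y' z.
Proof. by have := T_lin2 1 x y y' z; rewrite !scale1r. Qed.

Let T_D3 x y z z' : T x y (z + z') = T x y z + T x y z'.
Proof. by have := T_lin3 1 x y z z'; rewrite !scale1r. Qed.

Let T_01 y z : T 0 y z = 0.
Proof.
by apply: (@addrI _ (T 0 y z)); have := T_lin1 1 0 0 y z;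
  rewrite !scale1r !addr0.
Qed.

Let T_Z2 c x y z : T x (c *: y) z = c *: T x y z.
Proof.
have T0 : T x 0 z = 0 by apply: (@addrI _ (T x 0 z)); rewrite -T_D2 !addr0.
by have := T_lin2 c x y 0 z; rewrite T0 !addr0.
Qed.

Let T_Z3 c x y z : T x y (c *: z) = c *: T x y z.
Proof.
have T0 : T x y 0 = 0 by apply: (@addrI _ (T x y 0)); rewrite -T_D3 !addr0.
by have := T_lin3 c x y z 0; rewrite T0 !addr0.
Qed.

Lemma nabla_fieldDl X Y Z :
  nabla_field (X + Y) Z = nabla_field X Z + nabla_field Y Z.
Proof.
apply: vfield_eq => p; rewrite tan_vec_vfieldD !nabla_vec flat_vecDl.
by rewrite tan_vec_vfieldD T_D2 addrACA.
Qed.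

Lemma nabla_fieldZl (f : A) X Z :
  nabla_field (f *: X) Z = f *: nabla_field X Z.
Proof.
apply: vfield_eq => p; rewrite tan_vec_vfieldZ !nabla_vec flat_vecZl.
by rewrite tan_vec_vfieldZ T_Z2 scalerDr.
Qed.

Lemma nabla_fieldDr X Y Z :
  nabla_field X (Y + Z) = nabla_field X Y + nabla_field X Z.
Proof.
apply: vfield_eq => p; rewrite tan_vec_vfieldD !nabla_vec flat_vecDr.
by rewrite tan_vec_vfieldD T_D3 addrACA.
Qed.

Lemma nabla_fieldZr (f : A) X Y :
  nabla_field X (f *: Y) = (X f : A) *: Y + f *: nabla_field X Y.
Proof.
apply: vfield_eq => p; rewrite tan_vec_vfieldD !tan_vec_vfieldZ !nabla_vec.
by rewrite flat_vecZr tan_vec_vfieldZ T_Z3 scalerDr addrA.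
Qed.

Definition linear_connection : connection M :=
  Connection nabla_fieldDl nabla_fieldZl nabla_fieldDr nabla_fieldZr.

Lemma flat_vec_bracket X Y p :
  tan_vec (vf_at p (bracket X Y)) = flat_vec X Y p - flat_vec Y X p.
Proof.
rewrite addrC -scaleN1r -vec_linear; apply: vec_eq => i.
by rewrite mulN1r addrC.
Qed.

Lemma linear_connection_torsion_free :
  (forall x y z, T x y z = T x z y) -> torsion_free linear_connection.
Proof.
move=> T_sym X Y; apply: vfield_eq => p.
rewrite tan_vec_vfieldD tan_vec_vfieldN !nabla_vec flat_vec_bracket.
by rewrite (T_sym _ (tan_vec (vf_at p Y))) opprD addrACA subrr addr0.
Qed.

(** The trilinear term commutes with [J] by assumption, and the flat term does because the matrix of
    [J] is constant and passes through the derivation [X]. *)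
Lemma linear_connection_parallel (J : 'End(V)) (JJ : forall x, J (J x) = - x) :
  (forall x y z, T x y (J z) = J (T x y z)) ->
  parallel_acs linear_connection (constant_acs JJ).
Proof.
move=> TJ X Y; apply: vfield_eq => p /=.
rewrite end_fieldE end_atE !nabla_vec end_fieldE end_atE TJ linearD.
congr (_ + _).
transitivity (vec_at (end_comps J (fun i => X (comps Y i))) p); last first.
  exact: end_compsE.
apply: vec_eq => i.
congr (cinfty_fun _ p).
rewrite /comps vf_ofE vfield_sum; apply: eq_bigr => j _.
exact: vfieldZ.
Qed.

(** * Curvature at the origin *)

Section Origin.
Let o : M := (0 : 'rV[R]_n).

Let xo i : xcoord R i o = 0.
Proof. by rewrite /= mxE. Qed.

Lemma vec_origin : vec_at (@xcoord R n) o = 0.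
Proof. by rewrite /vec_at /vec big1// => i _; rewrite xo scale0r. Qed.

(** The position vanishes at the origin, so in the trilinear term [X] differentiates the position
    only, and the derivative of the position along [X] is [X] itself. *)
Lemma flat_vec_nabla X Y Z :
  flat_vec X (nabla_field Y Z) o =
  vec_at (fun i => X (Y (comps Z i))) o +
  T (tan_vec (vf_at o X)) (tan_vec (vf_at o Y)) (tan_vec (vf_at o Z)).
Proof.
rewrite -(trilinear_comps_tangent (vf_at o X)) //.
rewrite -[X in _ = X + _]scale1r -vec_linear; apply: vec_eq => i.
by rewrite /comps vf_ofE vfieldD cinfty_addE mul1r.
Qed.

(** The Christoffel symbols vanish at the origin, so the terms quadratic in them drop out; the
    second derivatives cancel against the flat derivative along the bracket. *)
Lemma curvature_origin X Y Z :
  tan_vec (vf_at o (curvature linear_connection X Y Z)) =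
  T (tan_vec (vf_at o X)) (tan_vec (vf_at o Y)) (tan_vec (vf_at o Z)) -
  T (tan_vec (vf_at o Y)) (tan_vec (vf_at o X)) (tan_vec (vf_at o Z)).
Proof.
rewrite /curvature !tan_vec_vfieldD !tan_vec_vfieldN /= !nabla_vec.
rewrite vec_origin !T_01 !addr0 !flat_vec_nabla.
set t := T _ _ _; set t' := T _ _ _.
have -> : flat_vec (bracket X Y) Z o =
    vec_at (fun i => X (Y (comps Z i))) o -
    vec_at (fun i => Y (X (comps Z i))) o.
  rewrite addrC -scaleN1r -vec_linear; apply: vec_eq => i.
  by rewrite mulN1r addrC.
rewrite [- (_ + t')]opprD [_ + t + _]addrACA [LHS]addrC.
by rewrite addKr.
Qed.

End Origin.

End LinearConnection.

End Model.

(** * Realization *)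

(** The coordinate vectors correspond to the basis vectors at every point, so an adapted basis makes
    the identity chart a complex one. *)
Lemma constant_acs_integrable (R : realType) (m : nat) (V : vectType R)
    (b : (m + m).-tuple V) (bP : basis_of fullv b) (J : 'End(V))
    (JJ : forall x, J (J x) = - x) :
  (forall i : 'I_m, J b`_(lshift m i) = b`_(rshift m i)) ->
  integrable_acs (constant_acs bP JJ).
Proof.
move=> Jb p; exists (id_chart R (m + m)); split=> //.
  by move=> d dA; split; exact: euclidean_compat.
move=> q _ i.
exists (vf_at q (pfield R (lshift m i))), (vf_at q (pfield R (rshift m i))).
have E k : tan_vec b (vf_at q (pfield R k)) = b`_k.
  rewrite /tan_vec /vec (bigD1 k)// big1 => [|j jk].
    by rewrite vf_atE pfield_coord eqxx scale1r [LHS]addr0.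
  by rewrite vf_atE pfield_coord eq_sym (negPf jk) scale0r.
have Jl : end_at b J (vf_at q (pfield R (lshift m i))) =
    vf_at q (pfield R (rshift m i)).
  by apply: (tan_vec_inj bP); rewrite (end_atE bP) !E Jb.
split=> //.
by rewrite -[in LHS]Jl; exact: (end_at_sq bP JJ).
Qed.

Local Close Scope classical_set_scope.

Theorem theorem1p8 (R : realType) (mbar : nat) (V : vectType R)
    (dimV : \dim {:V} = (mbar + mbar)%N)
    (J : 'End(V)) (JJ : (J \o J)%VF = - \1%VF)
    (A : 'Hom(V, 'Hom(V, 'End(V))))
    (A_skew : forall x y : V, A x y = - A y x)
    (A_bianchi : forall x y z : V, A x y z + A y z x + A z x y = 0)
    (A_kaehler : forall x y : V, (A x y \o J)%VF = (J \o A x y)%VF) :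
  exists (M : affine_kaehler R mbar) (P : M)
      (Xi : {linear V -> tangent P}) (Xi_inv : tangent P -> V),
    [/\ cancel Xi Xi_inv, cancel Xi_inv Xi,
        forall x y z : V,
          Xi_inv (curvature_at (ak_nabla M) (Xi x) (Xi y) (Xi z)) = A x y z
      & forall x : V, Xi_inv (ak_J M P (Xi x)) = J x].
Proof.
have JJ' x : J (J x) = - x by rewrite -comp_lfunE JJ opp_lfunE id_lfunE.
have [b [bP Jb]] := adapted_basis JJ' dimV.
pose a x y z := A x y z.
have J_lin c x x' : J (c *: x + x') = c *: J x + J x' by rewrite linearP.
have a_lin1 c x x' y z : a (c *: x + x') y z = c *: a x y z + a x' y z.
  by rewrite /a linearP !(add_lfunE, scale_lfunE).
have a_lin2 c x y y' z : a x (c *: y + y') z = c *: a x y z + a x y' z.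
  by rewrite /a linearP !(add_lfunE, scale_lfunE).
have a_lin3 c x y z z' : a x y (c *: z + z') = c *: a x y z + a x y z'.
  by rewrite /a linearP.
have a_skew x y z : a x y z = - a y x z by rewrite /a A_skew opp_lfunE.
have a_J x y z : a x y (J z) = J (a x y z).
  by rewrite /a -comp_lfunE A_kaehler comp_lfunE.
(* With [christoffel] as the trilinear term, its symmetry gives zero torsion and its commutation
   with [J] makes the complex structure parallel. *)
pose D := linear_connection bP (christoffel_linear1 J_lin a_lin1)
  (christoffel_linear2 J_lin a_lin2 a_lin3)
  (christoffel_linear3 J_lin a_lin2 a_lin3 JJ' a_skew A_bianchi a_J).
have D_tf : torsion_free D.
  by apply: linear_connection_torsion_free => *; exact: christoffel_sym.
have D_par : parallel_acs D (constant_acs bP JJ').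
  by apply: linear_connection_parallel => *; exact: christoffel_J.
exists (AffineKaehler (constant_acs_integrable bP JJ' Jb) D_tf D_par).
exists (0 : 'rV[R]_(mbar + mbar)), (@vec_tan _ _ _ b _), (@tan_vec _ _ _ b _).
split.
- exact: (vec_tanK bP).
- exact: (tan_vecK bP).
(* Only the values of the extensions at the origin enter [curvature_origin], and [extensionK]
   supplies them. *)
- move=> x y z; rewrite /curvature_at curvature_origin !extensionK.
  rewrite !(vec_tanK bP).
  exact: christoffel_curvature.
- by move=> x; rewrite /= (end_atE bP) (vec_tanK bP).
Qed.
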